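(* For every $\vec\lambda=(\lambda_1,\lambda_2,\lambda_3)\in\mathbb R^3$ there exist smooth symmetric $(0,2)$-tensors $\sigma,\tau$ on $\mathbb R^3$ with compact support in $A_1=\{1<|x|<2\}$, satisfying $\sigma(x)=\sigma(-x)$ and $\tau(x)=\tau(-x)$, such that \[L\sigma=0,\qquad \sum_i\tau_{ij,i}=0\ \ (j=1,2,3),\] and \[\int_{A_1}\Big[\tfrac12\tau_{ij,l}(Y_k)^l+\tau_{il}(Y_k)^l_{,j}\Big]\sigma_{ij}\,dx=\lambda_k\quad(k=1,2,3),\] with summation over $i,j,l$, where $Y_k=\frac{\partial}{\partial x^k}\times\vec x$.
   Context: Cartesian coordinates on $\mathbb R^3$; commas denote partial derivatives, and $\times$ the cross product. $L\sigma=\sum_{i,j}(\sigma_{ij,ij}-\sigma_{ii,jj})$ is the linearization of scalar curvature at the Euclidean metric. $\sigma(x)=\sigma(-x)$ means the Cartesian components are even functions. *)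

(* Defs.v *)
From HB Require Import structures.
From mathcomp Require Import all_boot all_order all_algebra.
From mathcomp Require Import all_classical all_reals all_analysis.
Set Implicit Arguments. Unset Strict Implicit. Unset Printing Implicit Defensive.
Import Order.TTheory GRing.Theory Num.Theory.
Import numFieldNormedType.Exports.
Local Open Scope classical_set_scope.
Local Open Scope ring_scope.

Section Defs.
Variable R : realType.

Notation pt := 'rV[R]_3.

Definition ebasis (i : 'I_3) : pt := delta_mx 0 i.

Definition enorm (x : pt) : R := Num.sqrt (\sum_(i < 3) x 0 i ^+ 2).

Definition mkpt (a b c : R) : pt := \row_(i < 3) [:: a; b; c]`_i.

Definition partial (i : 'I_3) (f : pt -> R) : pt -> R :=
  fun x => 'D_(ebasis i) f x.

Definition iterd (s : seq 'I_3) (f : pt -> R) : pt -> R :=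
  foldr partial f s.

Definition smooth (f : pt -> R) : Prop :=
  forall s : seq 'I_3, continuous (iterd s f) /\
    (forall (i : 'I_3) (x : pt), derivable (iterd s f) x (ebasis i)).

Definition support (f : pt -> R) : set pt := closure [set x | f x != 0].

Definition A1 : set pt := [set x | 1 < enorm x < 2].

Definition compact_support_in_A1 (f : pt -> R) : Prop :=
  compact (support f) /\ support f `<=` A1.

Definition cross (a b : pt) : pt :=
  \row_(l < 3) (a 0 (ordS l) * b 0 (ordS (ordS l))
                - a 0 (ordS (ordS l)) * b 0 (ordS l)).

Definition Yfield (k : 'I_3) (x : pt) : pt := cross (ebasis k) x.

Definition admissible (s : 'I_3 -> 'I_3 -> pt -> R) : Prop :=
  (forall i j, smooth (s i j)) /\
  (forall i j, s i j = s j i) /\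
  (forall i j, compact_support_in_A1 (s i j)) /\
  (forall i j x, s i j x = s i j (- x)).

Definition Lop (s : 'I_3 -> 'I_3 -> pt -> R) (x : pt) : R :=
  \sum_(i < 3) \sum_(j < 3)
     (partial j (partial i (s i j)) x - partial j (partial j (s i i)) x).

Definition divT (t : 'I_3 -> 'I_3 -> pt -> R) (j : 'I_3) (x : pt) : R :=
  \sum_(i < 3) partial i (t i j) x.

Definition integral3 (F : pt -> R) : R :=
  Rintegral lebesgue_measure setT (fun a =>
    Rintegral lebesgue_measure setT (fun b =>
      Rintegral lebesgue_measure setT (fun c => F (mkpt a b c)))).

Definition integrand (s t : 'I_3 -> 'I_3 -> pt -> R) (k : 'I_3) (x : pt) : R :=
  \sum_(i < 3) \sum_(j < 3) \sum_(l < 3)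
    ((2%:R)^-1 * partial l (t i j) x * (Yfield k x) 0 l
     + t i l x * partial j (fun y => (Yfield k y) 0 l) x) * s i j x.

Definition integral_A1 (F : pt -> R) : R :=
  integral3 (fun x => if `[< A1 x >] then F x else 0).

End Defs.

(* Main.v *)
(**
Let f = A_0(x_0) A_1(x_1) A_2(x_2) and g = al_0(x_0) al_1(x_1) al_2(x_2), where the
al_j are even bumps and A_j is odd, compactly supported and equal to the identity
near the support of al_j; the supports are placed so that those of f and g lie in
A_1. Put sigma_ij = mu_k d_k f for {i, j, k} = {0, 1, 2} and sigma_ii = 0: then sigma
is trace free with double divergence 2 (mu_0 + mu_1 + mu_2) d_0 d_1 d_2 f, so
L sigma = 0 when the mu_k sum to 0. Let tau be the double curl of phi, phi_ii = 0 and
phi_ij = w_k g, which is divergence free. On the support of tau one has f = x_0 x_1 x_2,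
so that the integrand is a sum of products of a monomial with a derivative of g, and
integration by parts yields 2 w_k (mu_(k+2) - mu_(k+1)) times the integral of g for
the field Y_k. Taking the mu_k distinct, the w_k can be chosen to reach any lambda.
*)
Require Import Defs.
From HB Require Import structures.
From mathcomp Require Import all_boot all_order all_algebra.
From mathcomp Require Import all_classical all_reals all_analysis.
From mathcomp Require Import ring lra.
Import Order.TTheory GRing.Theory Num.Theory.
Import numFieldNormedType.Exports.
Local Open Scope classical_set_scope.
Local Open Scope ring_scope.

(** * Smooth functions of one real variable *)

Section SmoothReal.
Context {R : realType}.
Implicit Types (f g : R -> R) (n : nat) (x : R).

(** Recursing on [derive1] suits induction on the order: a known pointwise derivative lowers it by
    one. *)
Fixpoint nderivable n f : Prop :=
  if n is m.+1 then (forall x, derivable f x 1) /\ nderivable m (derive1 f)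
  else True.

Definition smooth1 f := forall n, nderivable n f.

Lemma is_derive_derive1 f g :
  (forall x, is_derive x 1 f (g x)) -> derive1 f = g.
Proof. by move=> fg; apply/funext => x; rewrite derive1E derive_val. Qed.

Lemma nderivableS n f g :
  (forall x, is_derive x 1 f (g x)) -> nderivable n g -> nderivable n.+1 f.
Proof.
move=> fg ng /=; split=> [x|]; first exact: ex_derive.
by rewrite (is_derive_derive1 _ _ fg).
Qed.

Lemma nderivableW n f : nderivable n.+1 f -> nderivable n f.
Proof. by elim: n f => // n IHn f [df /IHn]. Qed.

Lemma nderivable_is_derive n f x : nderivable n.+1 f -> is_derive x 1 f (derive1 f x).
Proof. by move=> [df _]; rewrite derive1E; exact: derivableP. Qed.

Lemma nderivable_cst n (c : R) : nderivable n (fun=> c).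
Proof. by elim: n c => // n IHn c; apply: (@nderivableS _ _ (fun=> 0)). Qed.

Lemma nderivable_id n : nderivable n (fun x : R => x).
Proof.
by case: n => // n; apply: (@nderivableS _ _ (fun=> 1)) (nderivable_cst _ _).
Qed.

Lemma nderivableD n f g :
  nderivable n f -> nderivable n g -> nderivable n (fun x => f x + g x).
Proof.
elim: n f g => // n IHn f g nf ng.
apply: (@nderivableS _ _ (fun x => derive1 f x + derive1 g x)) => [x|].
  have := nderivable_is_derive _ _ x nf; have := nderivable_is_derive _ _ x ng.
  by move=> dg df; exact: is_deriveD.
by apply: IHn; [case: nf | case: ng].
Qed.

Lemma nderivableM n f g :
  nderivable n f -> nderivable n g -> nderivable n (fun x => f x * g x).
Proof.
elim: n f g => // n IHn f g nf ng.
apply: (@nderivableS _ _ (fun x => f x * derive1 g x + g x * derive1 f x)) => [x|].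
  have := nderivable_is_derive _ _ x nf; have := nderivable_is_derive _ _ x ng.
  by move=> dg df; exact: is_deriveM.
by apply: nderivableD; apply: IHn; try exact: nderivableW; [case: ng | case: nf].
Qed.

Lemma nderivable_comp n f g :
  nderivable n f -> nderivable n g -> nderivable n (fun x => f (g x)).
Proof.
elim: n f g => // n IHn f g nf ng.
apply: (@nderivableS _ _ (fun x => derive1 f (g x) * derive1 g x)) => [x|].
  have := nderivable_is_derive _ _ (g x) nf; have := nderivable_is_derive _ _ x ng.
  by move=> dg df; exact: is_derive1_comp.
apply: nderivableM; last by case: ng.
by apply: IHn; [case: nf | exact: nderivableW].
Qed.

Lemma nderivableV n f :
  (forall x, f x != 0) -> nderivable n f -> nderivable n (fun x => (f x)^-1).
Proof.
move=> f0; elim: n => // n IHn nf.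
apply: (@nderivableS _ _ (fun x => - 1 * ((f x)^-1 * (f x)^-1) * derive1 f x)) => [x|].
  have df := nderivable_is_derive _ _ x nf.
  apply: is_derive_eq (is_deriveV (f0 x) df) _.
  by rewrite mulN1r -invfM -expr2.
have nfV := IHn (nderivableW _ _ nf).
apply: nderivableM; last by case: nf.
by apply: nderivableM; [exact: nderivable_cst | exact: nderivableM].
Qed.

Lemma smooth1_derivable f n x : smooth1 f -> derivable (derive1n n f) x 1.
Proof.
elim: n f => [|n IHn] f sf; first by case: (sf 1%N).
by rewrite derive1Sn; apply: IHn => m; case: (sf m.+1).
Qed.

Lemma smooth1_is_derive f n x :
  smooth1 f -> is_derive x 1 (derive1n n f) (derive1n n.+1 f x).
Proof.
by move=> sf; rewrite derive1nS derive1E; exact/derivableP/smooth1_derivable.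
Qed.

Lemma smooth1_continuous f n : smooth1 f -> continuous (derive1n n f).
Proof.
move=> sf x; apply: differentiable_continuous; apply/derivable1_diffP.
exact: smooth1_derivable.
Qed.

(** * A function flat at the origin *)

Definition flat n x : R := if 0 < x then x^-1 ^+ n * expR (- x^-1) else 0.

Lemma flat_gt0E n x : 0 < x -> flat n x = x^-1 ^+ n * expR (- x^-1).
Proof. by rewrite /flat => ->. Qed.

Lemma flat_le0E n x : x <= 0 -> flat n x = 0.
Proof. by rewrite /flat leNgt => /negbTE ->. Qed.

Lemma is_derive_expn f n x (df : R) :
  is_derive x 1 f df -> is_derive x 1 (fun y => f y ^+ n) (n%:R * f x ^+ n.-1 * df).
Proof.
move=> fx; elim: n => [|n IHn]; first by rewrite !mul0r; exact: is_derive_cst.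
rewrite (_ : (fun y => _) = (fun y => f y * f y ^+ n)); last first.
  by apply/funext => y; rewrite exprS.
have dM := is_deriveM fx IHn; apply: (is_derive_eq dM); rewrite /GRing.scale /=.
by case: n {IHn dM} => [|n]; rewrite ?exprS/= -?natr1; ring.
Qed.

(** For $x>0$ one term of the exponential series at $1/x$ gives $x^{-(n+1)}\le (n+1)!\,e^{1/x}$. A
    linear bound is what the derivative at 0 needs. *)
Lemma flat_le n x : `|flat n x| <= n.+1`!%:R * `|x|.
Proof.
rewrite /flat; case: ifPn => [x0|_]; last by rewrite normr0 mulr_ge0.
have y0 : 0 < x^-1 by rewrite invr_gt0.
rewrite ger0_norm ?mulr_ge0 ?exprn_ge0 ?expR_ge0 ?(ltW y0)// gtr0_norm//.
rewrite expRN ler_pdivrMr ?expR_gt0//.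
have f0 : 0 < n.+1`!%:R :> R by rewrite ltr0n fact_gt0.
have : x^-1 ^+ n.+1 <= n.+1`!%:R * expR x^-1.
  rewrite mulrC -ler_pdivrMr//; apply: le_trans (expR_ge1Dxn n (ltW y0)).
  by rewrite lerDr.
rewrite -(ler_pM2l x0) exprS mulrA mulfV ?gt_eqF// mul1r.
by move/le_trans; apply; rewrite mulrCA mulrA.
Qed.

Lemma flat_is_derive n x :
  is_derive x 1 (flat n) (- n%:R * flat n.+1 x + flat n.+2 x).
Proof.
have [x0|x0|->] := ltgtP x 0.
- have e : \near x, 0 = flat n x.
    by apply: filterS (lt_nbhsl x0) => y /ltW /flat_le0E ->.
  rewrite !flat_le0E ?ltW// mulr0 addr0.
  by apply: (near_eq_is_derive e); exact: is_derive_cst.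
- have e : \near x, x^-1 ^+ n * expR (- x^-1) = flat n x.
    by apply: filterS (lt_nbhsr x0) => y /flat_gt0E ->.
  rewrite !flat_gt0E//; apply: (near_eq_is_derive e).
  have dV : is_derive x 1 (fun y : R => y^-1) (- x ^- 2 *: 1).
    by apply: is_deriveV; rewrite ?gt_eqF.
  have dE : is_derive x 1 (fun y : R => expR (- y^-1))
      (expR (- x^-1) * (- (- x ^- 2 *: 1))).
    exact: (is_derive1_comp (g := fun y => - y^-1)).
  have dM := is_deriveM (is_derive_expn _ n _ _ dV) dE.
  apply: (is_derive_eq dM).
  rewrite /GRing.scale /=.
  case: n {e dM} => [|n] /=; last rewrite !exprS.
    by rewrite expr0; field; rewrite gt_eqF.
  by field; rewrite gt_eqF.
- rewrite [X in is_derive _ _ _ X](_ : _ = 0); last by rewrite !flat_le0E// mulr0 addr0.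
  have c : (fun h => h^-1 *: ((flat n \o shift 0) (h *: 1) - flat n 0)) @ 0^'
      --> (0 : R).
    (* At 0, dividing by [h] raises the index: the difference quotient is [flat n.+1], which tends
       to 0 by [flat_le]. *)
    have e : (fun h => h^-1 *: ((flat n \o shift 0) (h *: 1) - flat n 0)) = flat n.+1.
      apply/funext => h; rewrite /flat ltxx subr0 /= addr0 [h *: 1]mulr1 /GRing.scale/=.
      by case: ifP => // _; rewrite ?mulr0// exprS mulrA.
    rewrite e; apply/cvgr0Pnorm_le => _/posnumP[eps].
    near=> h; apply: le_trans (flat_le _ _) _.
    have f0 : 0 < n.+2`!%:R :> R by rewrite ltr0n fact_gt0.
    rewrite mulrC -ler_pdivlMr//; near: h.
    apply: (@dnbhs0_le R R); exact: divr_gt0.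
  by apply: DeriveDef; [apply/cvg_ex; exists 0 | exact: cvg_lim c].
Unshelve. all: by end_near. Qed.

(** Differentiation turns [flat n] into a combination of [flat n.+1] and [flat n.+2], so the
    induction on the order treats all indices at once. *)
Lemma smooth1_flat : smooth1 (flat 0).
Proof.
move=> m; elim: m 0%N => // m IHm n.
apply: (nderivableS _ _ _ (flat_is_derive n)).
by apply: nderivableD => //; apply: nderivableM => //; exact: nderivable_cst.
Qed.

Lemma smooth1_derive1n n f : smooth1 f -> smooth1 (derive1n n f).
Proof.
elim: n f => // n IHn f sf; rewrite derive1Sn.
by apply: IHn => m; case: (sf m.+1).
Qed.

Lemma smooth1M f g : smooth1 f -> smooth1 g -> smooth1 (fun x => f x * g x).
Proof. by move=> sf sg n; exact: nderivableM. Qed.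

Lemma smooth1_comp f g : smooth1 f -> smooth1 g -> smooth1 (fun x => f (g x)).
Proof. by move=> sf sg n; exact: nderivable_comp. Qed.

Lemma smooth1_affine (a b : R) : smooth1 (fun x => a * x + b).
Proof.
by move=> n; apply: nderivableD (nderivable_cst _ _);
  apply: nderivableM (nderivable_cst _ _) (nderivable_id _).
Qed.

Lemma smooth1_expn n : smooth1 (fun x : R => x ^+ n).
Proof.
elim: n => [|n IHn] m; first exact: nderivable_cst.
rewrite (_ : (fun x => _) = (fun x : R => x * x ^+ n)); last first.
  by apply/funext => x; rewrite exprS.
by apply: nderivableM => //; exact: nderivable_id.
Qed.

Lemma eq_derive1n_open (U : set R) f g n x :
  open U -> {in U, f =1 g} -> U x -> derive1n n f x = derive1n n g x.
Proof.
move=> oU fg; elim: n x => [|n IHn] x Ux; first by rewrite /= fg// inE.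
rewrite !derive1nS !derive1E; apply: near_eq_derive.
have nU : nbhs x U by exact: open_nbhs_nbhs.
by apply: filterS nU => y; exact: IHn.
Qed.

Lemma derive1n_cst n (c : R) x : derive1n n.+1 (fun=> c) x = 0.
Proof.
elim: n x => [|n IHn] x; first by rewrite derive1nS derive1E derive_cst.
rewrite derive1nS (_ : derive1n n.+1 _ = fun=> 0); first by rewrite derive1E derive_cst.
exact/funext.
Qed.

Lemma derive1n_zero n x : derive1n n (fun=> 0 : R) x = 0.
Proof. by case: n => // n; rewrite derive1n_cst. Qed.

(** Differentiating $f(-y)=c f(y)$ by the chain rule adds a factor $-1$ per order. *)
Lemma derive1n_parity f (c : R) n x : smooth1 f ->
  (forall y, f (- y) = c * f y) ->
  derive1n n f (- x) = (-1) ^+ n * c * derive1n n f x.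
Proof.
move=> sf fc; elim: n x => [|n IHn] x; first by rewrite /= mul1r fc.
have d1 := smooth1_is_derive _ n (- x) sf.
have d2 := smooth1_is_derive _ n x sf.
have dl : is_derive x 1 (fun y => derive1n n f (- y)) (derive1n n.+1 f (- x) * (- 1)).
  exact: (is_derive1_comp (g := fun y => - y)).
have dr : is_derive x 1 (fun y => derive1n n f (- y))
    ((-1) ^+ n * c * derive1n n.+1 f x).
  rewrite (_ : (fun y => _) = ((-1) ^+ n * c) \*: derive1n n f); last exact/funext.
  exact: is_deriveZ.
move: (@derive_val _ _ _ _ _ _ _ dr); rewrite (@derive_val _ _ _ _ _ _ _ dl) => e.
by rewrite exprS -mulrA -mulrA mulN1r mulrA -e mulrN1 opprK.
Qed.

(** Bounds on squares add up to bounds on $|x|^2$ and are symmetric; a negative [u] imposes no lower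
    bound. *)
Definition sqitv (u v : R) : set R := [set x | u <= x ^+ 2 <= v].

Lemma continuous_sqr : continuous (fun x : R => x ^+ 2).
Proof. by move=> x; exact: (smooth1_continuous _ 0 (smooth1_expn 2)). Qed.

Lemma closed_sqitv u v : closed (sqitv u v).
Proof.
have -> : sqitv u v = (fun x => x ^+ 2) @^-1` [set` `[u, v]].
  by apply/seteqP; split => x; rewrite /sqitv/= in_itv.
by apply: closed_comp; [move=> x _; exact: continuous_sqr | exact: itv_closed].
Qed.

Lemma derive1n_sqitv f u v n x :
  (forall y, ~ sqitv u v y -> f y = 0) -> ~ sqitv u v x -> derive1n n f x = 0.
Proof.
move=> f0 ux; rewrite -[RHS](derive1n_zero n x).
apply: (@eq_derive1n_open (~` sqitv u v)) => //.
  exact/closed_openC/closed_sqitv.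
by move=> y; rewrite inE => /f0.
Qed.

(** * Smooth cutoffs and bumps of one variable *)

Definition step x := flat 0 x / (flat 0 x + flat 0 (1 - x)).

Lemma flat0_ge0 x : 0 <= flat 0 x.
Proof. by rewrite /flat; case: ifP => // _; rewrite mul1r expR_ge0. Qed.

Lemma flat0_gt0 x : 0 < x -> 0 < flat 0 x.
Proof. by move=> x0; rewrite flat_gt0E// mul1r expR_gt0. Qed.

Lemma step_denom_neq0 x : flat 0 x + flat 0 (1 - x) != 0.
Proof.
rewrite gt_eqF//; have [x0|x0] := ltP 0 x.
  by apply: ltr_pwDl (flat0_ge0 _); exact: flat0_gt0.
by apply: ltr_pwDr (flat0_ge0 _); apply: flat0_gt0; lra.
Qed.

Lemma smooth1_step : smooth1 step.
Proof.
apply: smooth1M => [|n]; first exact: smooth1_flat.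
apply: nderivableV step_denom_neq0 _.
apply: nderivableD (smooth1_flat n) _.
apply: (nderivable_comp _ _ (fun x => 1 - x)) (smooth1_flat n) _.
rewrite (_ : (fun x => _) = (fun x : R => - 1 * x + 1)); last first.
  by apply/funext => x; rewrite mulN1r addrC.
exact: smooth1_affine.
Qed.

Lemma step0 x : x <= 0 -> step x = 0.
Proof. by move=> x0; rewrite /step flat_le0E// mul0r. Qed.

Lemma step1 x : 1 <= x -> step x = 1.
Proof.
move=> x1; rewrite /step [flat 0 (1 - x)]flat_le0E ?subr_le0// addr0 divff// gt_eqF//.
by rewrite flat0_gt0// (lt_le_trans ltr01).
Qed.

(* Cutting off in terms of x ^+ 2 makes every profile even or odd. *)
Definition cutoff (u v x : R) :=
  step (8 * x ^+ 2 - 8 * u) * step (- 8 * x ^+ 2 + 8 * v).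

(** Equal to $x$ where $u+1/8\le x^2\le v-1/8$, since both steps in [cutoff] are 1 there. *)
Definition cutid (u v x : R) := x * cutoff u v x.

(** The margin 1/4 puts the support strictly inside the region where [cutid u v] is the identity.
    The factors [1] and [- 1] fit [smooth1_affine_sqr]. *)
Definition sqbump (u v x : R) :=
  flat 0 (1 * x ^+ 2 - (u + 4^-1)) * flat 0 (- 1 * x ^+ 2 + (v - 4^-1)).

Lemma smooth1_affine_sqr f (a b : R) :
  smooth1 f -> smooth1 (fun x => f (a * x ^+ 2 + b)).
Proof.
move=> sf; apply: (smooth1_comp _ (fun x => a * x ^+ 2 + b)) => //.
apply: (smooth1_comp (fun y => a * y + b)); first exact: smooth1_affine.
exact: smooth1_expn.
Qed.

Lemma smooth1_cutid u v : smooth1 (cutid u v).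
Proof.
apply: smooth1M; first by move=> n; exact: nderivable_id.
by apply: smooth1M; exact: smooth1_affine_sqr smooth1_step.
Qed.

Lemma smooth1_sqbump u v : smooth1 (sqbump u v).
Proof. by apply: smooth1M; exact: smooth1_affine_sqr smooth1_flat. Qed.

Lemma cutidN u v x : cutid u v (- x) = - 1 * cutid u v x.
Proof. by rewrite /cutid /cutoff sqrrN; ring. Qed.

Lemma sqbumpN u v x : sqbump u v (- x) = 1 * sqbump u v x.
Proof. by rewrite [RHS]mul1r /sqbump sqrrN. Qed.

Lemma cutid_eq0 u v x : ~ sqitv u v x -> cutid u v x = 0.
Proof.
move=> /negP; rewrite negb_and -!ltNge /cutid /cutoff => /orP[] xuv.
  by rewrite step0 ?mul0r ?mulr0//; lra.
by rewrite [step (- 8 * _ + _)]step0 ?mul0r ?mulr0//; lra.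
Qed.

Lemma sqbump_eq0 u v x : ~ sqitv (u + 4^-1) (v - 4^-1) x -> sqbump u v x = 0.
Proof.
move=> /negP; rewrite negb_and -!ltNge /sqbump => /orP[] xuv.
  by rewrite flat_le0E ?mul0r ?mulr0//; lra.
by rewrite [flat 0 (- 1 * _ + _)]flat_le0E ?mul0r ?mulr0//; lra.
Qed.

Lemma sqbump_ge0 u v x : 0 <= sqbump u v x.
Proof. by rewrite mulr_ge0// flat0_ge0. Qed.

Lemma sqbump_gt0 u v x : u + 4^-1 < x ^+ 2 < v - 4^-1 -> 0 < sqbump u v x.
Proof. by move=> /andP[ux xv]; rewrite mulr_gt0// flat0_gt0//; lra. Qed.

(** Near any point where a derivative of the bump can be nonzero, [cutid u v] is $x$. Beyond order 1
    the truncated exponent [1 - m] would give 1 instead of 0. *)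
Lemma sqbump_cutid u v n m x : (m < 2)%N ->
  derive1n n (sqbump u v) x * derive1n m (cutid u v) x =
  derive1n n (sqbump u v) x * x ^+ (1 - m).
Proof.
move=> m2; have [ux|ux] := pselect (sqitv (u + 4^-1) (v - 4^-1) x); last first.
  by rewrite (derive1n_sqitv _ _ _ _ _ (@sqbump_eq0 u v) ux) !mul0r.
congr (_ * _).
(* The margin 1/8, smaller than the 1/4 of the bump, leaves an open neighbourhood on which both
   steps are 1. *)
pose U := (fun x : R => x ^+ 2) @^-1` [set` `]u + 8^-1, v - 8^-1[].
have oU : open U.
  by apply: open_comp; [move=> y _; exact: continuous_sqr | exact: itv_open].
have Ux : U x by rewrite /U/= in_itv/=; move: ux; rewrite /sqitv/=; lra.
rewrite (@eq_derive1n_open U _ (fun x => x) _ _ oU) => //.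
  case: m m2 => [|[|//]] _; first by rewrite expr1.
  by rewrite derive1nS derive1E derive_id.
move=> y; rewrite inE /U/= in_itv/= => Uy.
by rewrite /cutid /cutoff !step1 ?mulr1//; move: Uy; lra.
Qed.

End SmoothReal.

(** * Moments of a bump *)

Section Integral.
Context {R : realType}.
Implicit Types (f g : R -> R) (n : nat) (x : R).
Local Notation mu := (@lebesgue_measure R).

(** Carrying integrability along with the value makes linearity applicable. *)
Definition has_integral f (v : R) :=
  mu.-integrable setT (EFin \o f) /\ Rintegral mu setT f = v.

Lemma has_integralD f g v w :
  has_integral f v -> has_integral g w -> has_integral (fun x => f x + g x) (v + w).
Proof.
move=> [fi <-] [gi <-]; split; last by rewrite RintegralD.
exact: (integrableD measurableT fi gi).
Qed.

Lemma has_integralZ f v (c : R) :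
  has_integral f v -> has_integral (fun x => c * f x) (c * v).
Proof.
move=> [fi <-]; split; last by rewrite RintegralZl.
exact: (integrableZl measurableT c fi).
Qed.

Lemma continuous_has_integral f (r : R) : continuous f ->
  (forall x, x \notin `[- r, r] -> f x = 0) ->
  has_integral f (Rintegral mu `[- r, r] f).
Proof.
move=> fc f0.
have fE : f \_ `[- r, r] = f.
  apply/funext => x; rewrite patchE; case: ifPn => //.
  by move=> /negP xr; rewrite f0//; apply/negP => x'; apply: xr; rewrite inE.
split; last by rewrite [RHS]Rintegral_mkcond fE.
rewrite -fE -restrict_EFin; apply: (iffLR (integrable_mkcond _ _)) => //.
apply: continuous_compact_integrable; first exact: segment_compact.
exact: continuous_subspaceT.
Qed.

Lemma has_integral_derive1 f (r : R) : 0 < r -> smooth1 f ->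
  (forall x, x \notin `]- r, r[ -> f x = 0) -> has_integral (derive1 f) 0.
Proof.
move=> r0 sf f0.
have f'0 x : x \notin `[- r, r] -> derive1 f x = 0.
  move=> xr; have -> : derive1 f x = derive1n 1 (fun=> 0 : R) x.
    apply: (@eq_derive1n_open _ (~` [set` `[- r, r]]) f _ 1) => //.
    - exact/closed_openC/itv_closed.
    - move=> y; rewrite inE /= => yr; apply: f0; apply/negP => yr'; apply: yr.
      by apply: subset_itv_oo_cc.
    - exact/negP.
  exact: derive1n_zero.
have rr : - r < r by rewrite gtrN.
have fr : f r = 0 by rewrite f0// in_itv/= ltxx andbF.
have fNr : f (- r) = 0 by rewrite f0// in_itv/= ltxx.
have [? E] := continuous_has_integral _ _ (smooth1_continuous _ 1 sf) f'0.
split=> //; rewrite E /Rintegral (@continuous_FTC2 _ _ f)//.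
- by rewrite fr fNr subee.
- by apply: continuous_subspaceT; exact: (smooth1_continuous _ 1 sf).
- by split=> [x _||]; [exact: (smooth1_derivable _ 0)|
    apply: cvg_at_right_filter; exact: (smooth1_continuous _ 0 sf)|
    apply: cvg_at_left_filter; exact: (smooth1_continuous _ 0 sf)].
Qed.

(** By continuity [f] exceeds $f(a)/2$ near [a], so its integral dominates that of a positive
    constant on a short interval. *)
Lemma has_integral_gt0 f (r a : R) : continuous f ->
  (forall x, 0 <= f x) -> (forall x, x \notin `[- r, r] -> f x = 0) ->
  0 < f a -> 0 < Rintegral mu setT f.
Proof.
move=> fc f0 fr fa.
have [fi _] := continuous_has_integral _ _ fc fr.
have : \forall x \near a, f a / 2 < f x.
  by apply: cvgr_gt (fc a) _ _; rewrite gtr_pMr// invf_lt1// ltr1n.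
case/nbhs_ballP => e /= e0 ae.
have e20 : 0 < e / 2 by rewrite divr_gt0.
pose I := `[a - e / 2, a + e / 2]%classic.
have Ii : mu.-integrable I (EFin \o (fun=> f a / 2)).
  apply: continuous_compact_integrable; first exact: segment_compact.
  by apply: continuous_subspaceT => x; exact: cvg_cst.
have le : Rintegral mu setT ((fun=> f a / 2) \_ I) <= Rintegral mu setT f.
  apply: le_Rintegral => //.
  - rewrite -restrict_EFin; apply: (iffLR (integrable_mkcond _ _) Ii).
    exact: measurable_itv.
  - move=> x _; case: ifPn => [|_]; last exact: f0.
    rewrite inE /I/= in_itv/= => xI; apply/ltW/ae; rewrite /ball/= ltr_norml.
    by move: xI; lra.
apply: lt_le_trans le; rewrite -Rintegral_mkcond Rintegral_cst//; last first.
  exact: measurable_itv.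
rewrite [X in _ * fine X](_ : _ = e%:E).
  by rewrite mulr_gt0// divr_gt0.
rewrite [LHS](lebesgue_measure_itv `[a - e / 2, a + e / 2])/= lte_fin ifT; last lra.
by rewrite -EFinB; congr (_%:E); lra.
Qed.

Section Moments.
Variables (al : R -> R) (r : R).
Hypotheses (r0 : 0 < r) (sal : smooth1 al).
Hypothesis al0 : forall x, x \notin `]- r, r[ -> al x = 0.

(** Derivatives vanish off the closed interval; widening by 1 restores the open interval asked by
    [has_integral_derive1]. *)
Let dal0 n x : x \notin `]- r - 1, r + 1[ -> derive1n n al x = 0.
Proof.
move=> xr; rewrite -[RHS](derive1n_zero n x).
apply: (@eq_derive1n_open _ (~` [set` `[- r, r]]) al) => //.
- exact/closed_openC/itv_closed.
- move=> y; rewrite inE /= => yr; apply: al0; apply/negP => yr'; apply: yr.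
  by apply: subset_itv_oo_cc.
- by move: xr => /negP xr xr'; apply: xr; move: xr'; rewrite /= !in_itv/=; lra.
Qed.

Definition moment m n : R := Rintegral mu setT (fun x => x ^+ m * derive1n n al x).

Let smooth_moment m n : smooth1 (fun x => x ^+ m * derive1n n al x).
Proof. by apply: smooth1M; [exact: smooth1_expn | exact: smooth1_derive1n]. Qed.

Lemma has_integral_moment m n :
  has_integral (fun x => x ^+ m * derive1n n al x) (moment m n).
Proof.
split=> //.
have [] := @continuous_has_integral (fun x => x ^+ m * derive1n n al x) (r + 1) => //.
  exact: (smooth1_continuous _ 0 (smooth_moment m n)).
move=> x xr; rewrite dal0 ?mulr0//; apply: contra xr.
by rewrite !in_itv/=; lra.
Qed.

Lemma moment0S n : moment 0 n.+1 = 0.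
Proof.
have [] := @has_integral_derive1 (derive1n n al) (r + 1); first by rewrite addr_gt0.
- exact: smooth1_derive1n.
- by move=> x xr; apply: dal0; rewrite -opprD.
move=> _ <-; apply: eq_Rintegral => x _; by rewrite mul1r.
Qed.

(** Integration by parts: the derivative of $x^{m+1}$ times the [n]-th derivative of [al] has
    integral 0. *)
Lemma momentSS m n : moment m.+1 n.+1 = - m.+1%:R * moment m n.
Proof.
have [] := @has_integral_derive1 (fun x => x ^+ m.+1 * derive1n n al x) (r + 1).
- by rewrite addr_gt0.
- exact: smooth_moment.
- by move=> x xr; rewrite dal0 ?mulr0// -opprD.
move=> _.
have -> : derive1 (fun x => x ^+ m.+1 * derive1n n al x) =
  (fun x => m.+1%:R * (x ^+ m * derive1n n al x) + x ^+ m.+1 * derive1n n.+1 al x).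
  apply: is_derive_derive1 => x.
  have dX := is_derive_expn id m.+1 x _ (is_derive_id _ _).
  have dM := is_deriveM dX (smooth1_is_derive _ n x sal).
  by apply: (is_derive_eq dM); rewrite /GRing.scale/=; ring.
have iZ := has_integralZ _ _ m.+1%:R (has_integral_moment m n).
have [_ ->] := has_integralD _ _ _ _ iZ (has_integral_moment m.+1 n.+1).
by move=> /eqP; rewrite addrC addr_eq0 mulNr => /eqP.
Qed.

End Moments.
End Integral.

(** * Tensor products of functions of one variable *)

Section Tensor.
Context {R : realType}.
Implicit Types (s : seq 'I_3) (p : seq (R * seq 'I_3)) (x : 'rV[R]_3).

Section Differentiation.
Variable G : 'I_3 -> R -> R.
Hypothesis sG : forall i, smooth1 (G i).

(** A mixed partial of the tensor product. Only multiplicities in [s] enter, so commuting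
    derivatives amounts to permuting [s]. *)
Definition dtens s x : R := \prod_(j < 3) derive1n (count_mem j s) (G j) (x 0 j).

(* The constant coefficient operator [\sum_(q <- p) q.1 * d^q.2] applied to the
   tensor product of the [G j]. *)
Definition diffop p x : R := \sum_(q <- p) q.1 * dtens q.2 x.

Definition dop i p := [seq (q.1, i :: q.2) | q <- p].

(** Along [ebasis R i] only the factor [i] varies, so the difference quotient is that of one factor
    times the constant [c]. *)
Lemma is_derive_dtens i s x :
  is_derive x (ebasis R i) (dtens s) (dtens (i :: s) x).
Proof.
pose c := \prod_(j < 3 | j != i) derive1n (count_mem j s) (G j) (x 0 j).
pose F := derive1n (count_mem i s) (G i).
have dF : is_derive (x 0 i) 1 F (derive1n (count_mem i s).+1 (G i) (x 0 i)).
  exact: smooth1_is_derive.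
have -> : dtens (i :: s) x = derive1n (count_mem i s).+1 (G i) (x 0 i) * c.
  rewrite /dtens (bigD1 i)//= eqxx add1n; congr (_ * _).
  by apply: eq_bigr => j ji; rewrite eq_sym (negbTE ji).
have q : (fun h : R => h^-1 *: ((dtens s \o shift x) (h *: ebasis R i) - dtens s x)) =
         (fun h : R => h^-1 *: ((F \o shift (x 0 i)) (h *: 1) - F (x 0 i)) * c).
  apply/funext => h; rewrite /GRing.scale/= -mulrA; congr (_ * _).
  rewrite /dtens (bigD1 i)//= [X in _ - X](bigD1 i)//= !mxE !eqxx/= mulrBl.
  congr (_ * _ - _); apply: eq_bigr => j ji; congr (derive1n _ _ _).
  by rewrite !mxE (negbTE ji) mulr0 add0r.
have lF : (fun h : R => h^-1 *: ((F \o shift (x 0 i)) (h *: 1) - F (x 0 i)) * c) @ 0^'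
   --> derive1n (count_mem i s).+1 (G i) (x 0 i) * c.
  apply: cvgMl; rewrite -(@derive_val _ _ _ _ _ _ _ dF).
  exact: (@ex_derive _ _ _ _ _ _ _ dF).
apply: DeriveDef; rewrite /derivable /derive q; last exact: cvg_lim lF.
by apply/cvg_ex; eexists; exact: lF.
Qed.

Lemma diffop_nil : diffop [::] = fun=> 0.
Proof. by apply/funext => x; rewrite /diffop big_nil. Qed.

Lemma diffop_cons q p : diffop (q :: p) = q.1 \*: dtens q.2 + diffop p.
Proof. by apply/funext => x; rewrite /diffop big_cons. Qed.

Lemma is_derive_diffop i p x :
  is_derive x (ebasis R i) (diffop p) (diffop (dop i p) x).
Proof.
elim: p => [|q p IHp]; first by rewrite diffop_nil; exact: is_derive_cst.
rewrite /dop/= !diffop_cons.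
by apply: is_deriveD IHp; apply: is_deriveZ; exact: is_derive_dtens.
Qed.

Lemma partial_diffop i p : partial i (diffop p) = diffop (dop i p).
Proof.
by apply/funext => x; exact: (@derive_val _ _ _ _ _ _ _ (is_derive_diffop i p x)).
Qed.

Lemma continuous_dtens s : continuous (dtens s).
Proof.
pose F r (x : 'rV[R]_3) := \prod_(j <- r) derive1n (count_mem j s) (G j) (x 0 j).
suff cr r : continuous (F r) by exact: cr.
elim: r => [|j r IHr] x.
  have -> : F [::] = fun=> 1 by apply/funext => y; rewrite /F big_nil.
  apply: cst_continuous.
have -> : F (j :: r) = fun y => derive1n (count_mem j s) (G j) (y 0 j) * F r y.
  by apply/funext => y; rewrite /F big_cons.
apply: cvgM (IHr x).
apply: (@continuous_comp _ _ _ (fun y : 'rV[R]_3 => y 0 j)).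
  exact: coord_continuous.
exact: smooth1_continuous.
Qed.

Lemma continuous_diffop p : continuous (diffop p).
Proof.
move=> x; elim: p => [|q p IHp]; first by rewrite diffop_nil; apply: cst_continuous.
rewrite diffop_cons.
apply: continuousD IHp; apply: continuousZl_tmp; exact: continuous_dtens.
Qed.

(** The family is stable under partial derivatives, so every iterated derivative is again a
    [diffop]. *)
Lemma smooth_diffop p : smooth (diffop p).
Proof.
move=> s; have -> : iterd s (diffop p) = diffop (foldr dop p s).
  by elim: s => //= i s ->; rewrite partial_diffop.
split; first exact: continuous_diffop.
by move=> i x; exact: (@ex_derive _ _ _ _ _ _ _ (is_derive_diffop i _ x)).
Qed.

Lemma size_count_ord3 s : size s = (\sum_(j < 3) count_mem j s)%N.
Proof.
elim: s => [|i s IHs]; first by rewrite big1.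
rewrite /= IHs big_split/= -add1n; congr addn.
by rewrite (bigD1 i)//= eqxx big1// => j ji; rewrite eq_sym (negbTE ji).
Qed.

Lemma dtens_parity s (c : 'I_3 -> R) x :
  (forall j y, G j (- y) = c j * G j y) ->
  dtens s (- x) = (-1) ^+ size s * (\prod_j c j) * dtens s x.
Proof.
move=> Gc; rewrite /dtens size_count_ord3 expr_sum -!big_split/=.
by apply: eq_bigr => j _; rewrite mxE; exact: derive1n_parity.
Qed.

Lemma diffop_even p (c : 'I_3 -> R) x :
  (forall j y, G j (- y) = c j * G j y) ->
  (forall q, q \in p -> (-1) ^+ size q.2 * \prod_j c j = 1) ->
  diffop p (- x) = diffop p x.
Proof.
move=> Gc pc; apply: eq_big_seq => q /pc qc.
by rewrite (dtens_parity _ _ _ Gc) qc mul1r.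
Qed.

Lemma dtens_neq0 s x (K : 'I_3 -> set R) :
  (forall j n y, ~ K j y -> derive1n n (G j) y = 0) ->
  dtens s x != 0 -> forall j, K j (x 0 j).
Proof.
move=> G0 /prodf_neq0 s0 j; apply: contrapT => /G0 Gj.
by have := s0 j isT; rewrite Gj eqxx.
Qed.

Lemma diffop_neq0 p x (K : 'I_3 -> set R) :
  (forall j n y, ~ K j y -> derive1n n (G j) y = 0) ->
  diffop p x != 0 -> forall j, K j (x 0 j).
Proof.
move=> G0; apply: contra_neqP => /existsNP[j Kj].
rewrite /diffop big1_seq// => q _; apply/eqP; rewrite mulf_eq0; apply/orP; right.
by apply: contra_notT Kj => /dtens_neq0; exact.
Qed.

End Differentiation.

(** * Compact boxes inside the shell *)

Definition sqbox (u v : 'I_3 -> R) : set 'rV[R]_3 :=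
  [set x | forall j, sqitv (u j) (v j) (x 0 j)].

Lemma compact_sqitv (u v : R) : compact (sqitv u v).
Proof.
(* Since $r\ge 1$, one has $x^2\le v\le r\le r^2$. *)
pose r := Num.max 1 v.
apply: (@subclosed_compact _ _ `[- r, r]) (@segment_compact _ _ _) _.
  exact: closed_sqitv.
have r1 : 1 <= r by rewrite le_max lexx.
have vr : v <= r by rewrite le_max lexx orbT.
move=> x /andP[_ xv]; rewrite /= in_itv/=; nra.
Qed.

Lemma compact_sqbox (u v : 'I_3 -> R) : compact (sqbox u v).
Proof.
by apply: (@rV_compact _ _ (fun j => sqitv (u j) (v j))) => j; exact: compact_sqitv.
Qed.

(** Coordinate [i] alone forces $|x|^2>1$, and the upper bounds add up to $|x|^2<4$; the box is
    closed, so it contains the closure too. *)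
Lemma sqbox_compact_support (u v : 'I_3 -> R) (f : 'rV[R]_3 -> R) i :
  1 < u i -> \sum_j v j < 4 ->
  (forall x, f x != 0 -> sqbox u v x) -> compact_support_in_A1 f.
Proof.
move=> u1 v4 fB.
have cB : closed (sqbox u v).
  by apply: compact_closed (@compact_sqbox u v); exact: norm_hausdorff.
have sB : Defs.support f `<=` sqbox u v.
  by rewrite [X in _ `<=` X](closure_id _).1//; apply: closure_subset.
split; first by apply: subclosed_compact (@compact_sqbox u v) sB; exact: closed_closure.
move=> x /sB Bx; rewrite /A1/= /enorm.
have su : 1 < \sum_j x 0 j ^+ 2.
  rewrite (bigD1 i)//= ltr_wpDr ?sumr_ge0// => [j _|]; first exact: sqr_ge0.
  by apply: lt_le_trans u1 _; case/andP: (Bx i).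
have sv : \sum_j x 0 j ^+ 2 < 4.
  by apply: le_lt_trans v4; apply: ler_sum => j _; case/andP: (Bx j).
rewrite -{1}sqrtr1 ltr_sqrt ?su/=; last by apply: lt_trans su.
have -> : 2 = Num.sqrt 4 :> R.
  by rewrite (_ : 4 = 2 ^+ 2) ?sqrtr_sqr ?ger0_norm//; ring.
by rewrite ltr_sqrt.
Qed.

End Tensor.

(** * Iterated integrals *)

Section Integral3.
Context {R : realType}.
Implicit Types (F G : 'rV[R]_3 -> R) (s t : seq 'I_3) (p : seq (R * seq 'I_3)).
Implicit Types (x : 'rV[R]_3).

(** Integrability is recorded at each stage, so that sums and multiples pass through all three
    integrals. *)
Definition has_integral3 F (v : R) := exists g h,
  [/\ forall a b, has_integral (fun c => F (mkpt a b c)) (g a b),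
      forall a, has_integral (g a) (h a) & has_integral h v].

Lemma has_integral3E F v : has_integral3 F v -> integral3 F = v.
Proof.
move=> [G [H [FG GH [_ <-]]]]; apply: eq_Rintegral => a _.
have [_ <-] := GH a; apply: eq_Rintegral => b _.
by have [_ <-] := FG a b.
Qed.

Lemma has_integral3D F G v w :
  has_integral3 F v -> has_integral3 G w -> has_integral3 (fun x => F x + G x) (v + w).
Proof.
move=> [F1 [F2 [F0 F1i F2i]]] [G1 [G2 [G0 G1i G2i]]].
exists (fun a b => F1 a b + G1 a b), (fun a => F2 a + G2 a).
by split=> *; exact: has_integralD.
Qed.

Lemma has_integral3Z F v (c : R) :
  has_integral3 F v -> has_integral3 (fun x => c * F x) (c * v).
Proof.
move=> [F1 [F2 [F0 F1i F2i]]].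
exists (fun a b => c * F1 a b), (fun a => c * F2 a).
by split=> *; exact: has_integralZ.
Qed.

Lemma has_integralZr (f : R -> R) v (c : R) :
  has_integral f v -> has_integral (fun y => f y * c) (v * c).
Proof.
rewrite mulrC (_ : (fun y => _) = (fun y => c * f y)); first exact: has_integralZ.
by apply/funext => y; rewrite mulrC.
Qed.

Lemma has_integral_cst0 : has_integral (fun=> 0 : R) 0.
Proof.
split; last by rewrite Rintegral_cst// mul0r.
exact: integrable0.
Qed.

Lemma has_integral3_prod (f : 'I_3 -> R -> R) (v : 'I_3 -> R) :
  (forall j, has_integral (f j) (v j)) ->
  has_integral3 (fun x => \prod_j f j (x 0 j)) (\prod_j v j).
Proof.
move=> fv.
pose j1 : 'I_3 := lift ord0 ord0; pose j2 : 'I_3 := lift ord0 (lift ord0 ord0).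
exists (fun a b => f ord0 a * f j1 b * v j2), (fun a => f ord0 a * v j1 * v j2).
split=> [a b|a|].
- have -> : (fun c => \prod_j f j (mkpt a b c 0 j)) =
            (fun c => (f ord0 a * f j1 b) * f j2 c).
    by apply/funext => c; rewrite !big_ord_recl big_ord0 !mxE/= mulr1 mulrA.
  exact: has_integralZ.
- by apply: has_integralZr; exact: has_integralZ.
- rewrite !big_ord_recl big_ord0 mulr1 mulrA.
  by apply: has_integralZr; exact: has_integralZr.
Qed.

Definition monomial s x : R := \prod_(j < 3) x 0 j ^+ count_mem j s.

Lemma monomial_cons i s x : monomial (i :: s) x = x 0 i * monomial s x.
Proof.
rewrite /monomial (bigD1 i)//= [in RHS](bigD1 i)//= eqxx add1n exprS -mulrA.
congr (_ * (_ * _)); apply: eq_bigr => j ji.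
by rewrite eq_sym (negbTE ji).
Qed.

Section Pairing.
Variables (al : 'I_3 -> R -> R) (r : R).
Hypothesis sal : forall j, smooth1 (al j).
Hypothesis al0 : forall j y, y \notin `]- r, r[ -> al j y = 0.

(** The integral of $x^s\,\partial^t g$, for $g$ the product of the [al j], factored into
    one-variable moments. *)
Definition pairing s t : R := \prod_j moment (al j) (count_mem j s) (count_mem j t).

Lemma has_integral3_pairing s p :
  has_integral3 (fun x => monomial s x * diffop al p x)
    (\sum_(q <- p) q.1 * pairing s q.2).
Proof.
elim: p => [|q p IHp].
  rewrite big_nil; under eq_fun do rewrite /diffop big_nil mulr0.
  by exists (fun _ _ => 0), (fun=> 0); split=> *; exact: has_integral_cst0.
rewrite big_cons.
have -> : (fun x => monomial s x * diffop al (q :: p) x) =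
  (fun x => q.1 * (monomial s x * dtens al q.2 x) + monomial s x * diffop al p x).
  by apply/funext => x; rewrite /diffop big_cons; ring.
apply: has_integral3D IHp; apply: has_integral3Z.
under eq_fun do rewrite /monomial /dtens -big_split/=.
apply: (has_integral3_prod (fun j y =>
  y ^+ count_mem j s * derive1n (count_mem j q.2) (al j) y)) => j.
exact: (has_integral_moment _ _ (sal j) (al0 j)).
Qed.

End Pairing.

End Integral3.

(** * Indices modulo 3 *)

Lemma ord3_enum (P : 'I_3 -> Prop) : P 0 -> P 1 -> P 2%:R -> forall k, P k.
Proof.
move=> P0 P1 P2 [[|[|[|//]]] k3].
- by rewrite (_ : Ordinal k3 = 0)//; exact: val_inj.
- by rewrite (_ : Ordinal k3 = 1)//; exact: val_inj.
- by rewrite (_ : Ordinal k3 = 2%:R)//; exact: val_inj.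
Qed.

Lemma ordS3 (l : 'I_3) : ordS l = l + 1.
Proof. by elim/ord3_enum: l; apply/val_inj. Qed.

Lemma sum_ord3 (V : nmodType) (F : 'I_3 -> V) k :
  \sum_i F i = F k + (F (k + 1) + F (k + 2%:R)).
Proof.
rewrite (bigD1 k)// (bigD1 (k + 1))/=; last by elim/ord3_enum: k.
rewrite (bigD1 (k + 2%:R))/=; last by elim/ord3_enum: k.
rewrite big_pred0 ?addr0// => j.
by elim/ord3_enum: k; elim/ord3_enum: j.
Qed.

(** A rewriting table for symbolic indices: sums, distinctness, third index. One computation then
    covers all cyclic cases. *)
Lemma ord3E (k : 'I_3) :
  ((k + 1 + 1 = k + 2%:R) * (k + 1 + 2%:R = k) *
   (k + 2%:R + 1 = k) * (k + 2%:R + 2%:R = k + 1)) *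
  ((k == k + 1 = false) * (k + 1 == k = false) * (k == k + 2%:R = false) *
   (k + 2%:R == k = false) * (k + 1 == k + 2%:R = false) *
   (k + 2%:R == k + 1 = false)) *
  ((- (k + (k + 1)) = k + 2%:R) * (- (k + 1 + k) = k + 2%:R) *
   (- (k + (k + 2%:R)) = k + 1) * (- (k + 2%:R + k) = k + 1) *
   (- (k + 1 + (k + 2%:R)) = k) * (- (k + 2%:R + (k + 1)) = k)).
Proof. by elim/ord3_enum: k; do !split; apply: val_inj. Qed.

(** * The bilinear form of the rotation fields *)

Section Rotation.
Context {R : realType}.
Implicit Types (x : 'rV[R]_3) (k : 'I_3).

Lemma partial_coord i j (c : R) x : partial i (fun y => c * y 0 j) x = c * (i == j)%:R.
Proof.
rewrite /partial /derive.
pose f := fun y : 'rV[R]_3 => c * y 0 j.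
have -> : (fun h : R => h^-1 *: ((f \o shift x) (h *: ebasis R i) - f x)) =
  (fun h : R => h^-1 * h * (c * (i == j)%:R)).
  by apply/funext => h; rewrite /f/= !mxE eqxx/= /GRing.scale/= eq_sym; ring.
apply: cvg_lim => //; apply: cvg_near_cst; near=> h.
rewrite mulVf ?mul1r//; near: h; exact: nbhs_dnbhs_neq.
Unshelve. all: by end_near. Qed.

(** The constant factors put every component in the form handled by [partial_coord]. *)
Lemma YfieldE k :
  ((fun x => Yfield k x 0 k) = (fun x => 0 * x 0 k)) *
  ((fun x => Yfield k x 0 (k + 1)) = (fun x => - 1 * x 0 (k + 2%:R))) *
  ((fun x => Yfield k x 0 (k + 2%:R)) = (fun x => 1 * x 0 (k + 1))).
Proof.
by do !split; apply/funext => x;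
  rewrite /Yfield /cross /ebasis !mxE !ordS3 ?ord3E ?eqxx ?ord3E ?eqxx/=; ring.
Qed.

(** Here $Y_k=x_i\partial_j-x_j\partial_i$. Symmetry counts each off-diagonal pair twice, absorbing
    the factor 1/2; the terms without derivatives of [t] come from the constant gradient of
    $Y_k$. *)
Lemma integrandE (s t : 'I_3 -> 'I_3 -> 'rV[R]_3 -> R) k x :
  let i := k + 1 in let j := k + 2%:R in
  (forall a b, s a b = s b a) -> (forall a y, s a a y = 0) ->
  (forall a b, t a b = t b a) ->
  integrand s t k x =
    x 0 i * (partial j (t i j) x * s i j x + partial j (t k i) x * s k i x +
             partial j (t k j) x * s k j x)
  - x 0 j * (partial i (t i j) x * s i j x + partial i (t k i) x * s k i x +
             partial i (t k j) x * s k j x)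
  + t k j x * s k i x + (t j j x - t i i x) * s i j x - t k i x * s k j x.
Proof.
move=> i j sC s0 tC; rewrite /integrand.
under eq_bigr => a _ do under eq_bigr => b _ do rewrite (sum_ord3 _ _ k).
under eq_bigr => a _ do rewrite (sum_ord3 _ _ k).
rewrite (sum_ord3 _ _ k).
have Y0 := fun y => congr1 (fun f => f y) (YfieldE k).1.1.
have Y1 := fun y => congr1 (fun f => f y) (YfieldE k).1.2.
have Y2 := fun y => congr1 (fun f => f y) (YfieldE k).2.
rewrite !YfieldE !partial_coord ?eqxx !ord3E.
rewrite /= in Y0 Y1 Y2; rewrite !Y0 !Y1 !Y2 !s0 -/i -/j.
rewrite (sC j i) (sC i k) (sC j k) (tC j i) (tC i k) (tC j k).
clearbody i j; rewrite {Y0 Y1 Y2}/=.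
(* Generalizing the atoms keeps [field] from comparing them up to conversion. *)
move: (x 0 k) (x 0 i) (x 0 j) (s k i x) (s k j x) (s i j x) => xk xi xj ski skj sij.
do ![move: (partial _ (t _ _) x) => ?]; do ![move: (t _ _ x) => ?].
by field.
Qed.

End Rotation.

(** * The tensors [sigma] and [tau] and the value of the bilinear form *)

Section Construction.
Context {R : realType}.
Implicit Types (x : 'rV[R]_3) (k : 'I_3).
Variables (A al : 'I_3 -> R -> R) (mu w : 'I_3 -> R).
Hypotheses (sA : forall j, smooth1 (A j)) (sal : forall j, smooth1 (al j)).

(* In 'I_3, seen as Z/3, the index different from two distinct a and b is
   - (a + b). *)
Definition sigma_op (a b : 'I_3) : seq (R * seq 'I_3) :=
  if a == b then [::] else [:: (mu (- (a + b)), [:: - (a + b)])].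

(* The components of eps_iab eps_jcd d_a d_c phi_bd for the symmetric tensor phi
   with zero diagonal and phi_ij = w_k g ({i, j, k} = {0, 1, 2}). *)
Definition tau_op (a b : 'I_3) : seq (R * seq 'I_3) :=
  if a == b then [:: (- 2 * w a, [:: a + 1; a + 2%:R])]
  else let c := - (a + b) in
    [:: (w a, [:: c; a]); (w b, [:: c; b]); (- w c, [:: c; c])].

Definition sigma a b := diffop A (sigma_op a b).

Definition tau a b := diffop al (tau_op a b).

Lemma sigmaC a b : sigma a b = sigma b a.
Proof. by rewrite /sigma /sigma_op eq_sym [a + b]addrC. Qed.

Lemma tauC a b : tau a b = tau b a.
Proof.
rewrite /tau /tau_op eq_sym [b + a]addrC; case: eqP => [->//|_].
by apply/funext => x; rewrite /diffop !big_cons !big_nil/=; ring.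
Qed.

Lemma dtens_perm (G : 'I_3 -> R -> R) s t : perm_eq s t -> dtens G s = dtens G t.
Proof.
move=> /permP st; apply/funext => x; apply: eq_bigr => j _.
by rewrite (st (pred1 j)).
Qed.

(** Every third derivative that occurs is the fully mixed one, and each [mu j] contributes twice. *)
Lemma Lop_sigma x : \sum_j mu j = 0 -> Lop sigma x = 0.
Proof.
(* A symbolic [k] keeps the indices in the form that [ord3E] rewrites. *)
pose k : 'I_3 := 0; clearbody k.
rewrite (sum_ord3 _ _ k) => mu0; rewrite /Lop.
under eq_bigr => i _ do rewrite (sum_ord3 _ _ k).
rewrite (sum_ord3 _ _ k) /sigma !(partial_diffop A sA) /diffop /sigma_op !eqxx !ord3E/=.
rewrite !big_cons !big_nil/=.
have swap (a b c : 'I_3) : dtens A [:: a; b; c] = dtens A [:: b; a; c].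
  by apply: dtens_perm; rewrite (perm_catCA [:: a] [:: b]).
have rot (a b c : 'I_3) : dtens A [:: a; b; c] = dtens A [:: b; c; a].
  by apply: dtens_perm; rewrite (perm_catC [:: a]).
rewrite (rot (k + 2%:R) (k + 1) k) (swap k (k + 2%:R)).
rewrite (rot (k + 2%:R) k) (swap (k + 1) k).
rewrite -(rot k); set d := dtens _ _ x.
transitivity (2 * (mu k + (mu (k + 1) + mu (k + 2%:R))) * d); first by ring.
by rewrite mu0 mulr0 mul0r.
Qed.

(** After commuting derivatives, the two off-diagonal terms in [w b] cancel the diagonal one, and
    those in the other two weights cancel in pairs. *)
Lemma divT_tau b x : divT tau b x = 0.
Proof.
rewrite /divT (sum_ord3 _ _ b).
rewrite /tau !(partial_diffop al sal) /diffop /tau_op !eqxx !ord3E/=.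
rewrite !big_cons !big_nil/=.
set i := b + 1; set j := b + 2%:R.
have swap (a c d : 'I_3) : dtens al [:: a; c; d] = dtens al [:: c; a; d].
  by apply: dtens_perm; rewrite (perm_catCA [:: a] [:: c]).
have rot (a c d : 'I_3) : dtens al [:: a; c; d] = dtens al [:: c; d; a].
  by apply: dtens_perm; rewrite (perm_catC [:: a]).
rewrite (swap j i) (swap j i i) (rot b i j) (swap j i b); ring.
Qed.

Variable r : R.
Hypothesis al0 : forall j y, y \notin `]- r, r[ -> al j y = 0.
Hypothesis alA : forall j n m y, (m < 2)%N ->
  derive1n n (al j) y * derive1n m (A j) y = derive1n n (al j) y * y ^+ (1 - m).

(** On the support of the bumps the product of the [A j] is $x_0x_1x_2$, whose [k]-th partial is
    $x_{k+1}x_{k+2}$. *)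
Lemma diffop_sigma p k x :
  diffop al p x * sigma (k + 1) (k + 2%:R) x =
  mu k * (monomial [:: k + 1; k + 2%:R] x * diffop al p x).
Proof.
have key s : dtens al s x * dtens A [:: k] x =
    monomial [:: k + 1; k + 2%:R] x * dtens al s x.
  rewrite /dtens /monomial -[in RHS]big_split -[LHS]big_split/=; apply: eq_bigr => j _.
  rewrite alA; last by case: eqP.
  (* The exponent, 0 if [j] is [k] and 1 otherwise, is the multiplicity of [j] in the monomial. *)
  by rewrite mulrC; congr (_ ^+ _ * _); elim/ord3_enum: k; elim/ord3_enum: j.
rewrite /sigma /sigma_op !ord3E {2}/diffop big_seq1/= mulrCA; congr (_ * _).
rewrite /diffop mulr_suml mulr_sumr; apply: eq_bigr => q _.
by rewrite -mulrA key mulrCA.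
Qed.

Lemma has_integral3_pairing_sum (l : seq (R * seq 'I_3 * seq (R * seq 'I_3))) :
  has_integral3 (fun x => \sum_(z <- l) z.1.1 * (monomial z.1.2 x * diffop al z.2 x))
    (\sum_(z <- l) z.1.1 * \sum_(q <- z.2) q.1 * pairing al z.1.2 q.2).
Proof.
elim: l => [|z l IHl].
  rewrite big_nil; under eq_fun do rewrite big_nil.
  by exists (fun _ _ => 0), (fun=> 0); split=> *; exact: has_integral_cst0.
rewrite big_cons; under eq_fun do rewrite big_cons.
apply: has_integral3D IHl; apply: has_integral3Z.
exact: (has_integral3_pairing _ _ sal al0).
Qed.

(** Integrating by parts [m] times leaves the integral of a derivative. *)
Lemma moment_eq0 j m n : 0 < r -> (m < n)%N -> moment (al j) m n = 0.
Proof.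
move=> r0; elim: m n => [|m IHm] [|n]// mn.
  exact: (moment0S _ _ r0 (sal j) (al0 j)).
by rewrite (momentSS _ _ r0 (sal j) (al0 j)) IHm ?mulr0.
Qed.

Lemma pairing_eq0 s t a :
  0 < r -> (count_mem a s < count_mem a t)%N -> pairing al s t = 0.
Proof. by move=> r0 st; rewrite /pairing (bigD1 a)//= moment_eq0 ?mul0r. Qed.

(** One integration by parts per index of [t], each with coefficient $-1$ since no exponent exceeds
    1. *)
Lemma pairing_perm s t : 0 < r -> perm_eq s t -> uniq t ->
  pairing al s t = (-1) ^+ size t * \prod_j moment (al j) 0 0.
Proof.
move=> r0 /permP st ut; rewrite size_count_ord3 expr_sum -big_split/=.
apply: eq_bigr => j _; rewrite (st (pred1 j)) count_uniq_mem//.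
case: (j \in t); last by rewrite mul1r.
by rewrite (momentSS _ _ r0 (sal j) (al0 j)) expr1.
Qed.

(* Homogeneity makes each pairing vanish unless the monomial and the derivative
   have the same exponents. *)
Lemma has_integral3_integrand k : 0 < r ->
  has_integral3 (integrand sigma tau k)
    (2 * w k * (mu (k + 2%:R) - mu (k + 1)) * \prod_j moment (al j) 0 0).
Proof.
move=> r0.
pose i := k + 1; pose j := k + 2%:R.
(* The ten terms of [integrandE] after [diffop_sigma]: coefficient, monomial, operator on the
   bumps. *)
pose l := [:: (mu k, [:: i; i; j], dop j (tau_op i j));
  (- mu k, [:: j; i; j], dop i (tau_op i j));
  (mu j, [:: i; k; i], dop j (tau_op k i));
  (- mu j, [:: j; k; i], dop i (tau_op k i));
  (mu i, [:: i; j; k], dop j (tau_op k j));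
  (- mu i, [:: j; j; k], dop i (tau_op k j));
  (mu j, [:: k; i], tau_op k j);
  (mu k, [:: i; j], tau_op j j);
  (- mu k, [:: i; j], tau_op i i);
  (- mu i, [:: j; k], tau_op k i)].
have := has_integral3_pairing_sum l.
have -> : (fun x => \sum_(z <- l) z.1.1 * (monomial z.1.2 x * diffop al z.2 x)) =
    integrand sigma tau k.
  apply/funext => x; rewrite integrandE; [|exact: sigmaC| |exact: tauC]; last first.
    by move=> a y; rewrite /sigma /sigma_op eqxx diffop_nil.
  rewrite -/i -/j (sigmaC k j).
  have s1 p : diffop al p x * sigma i j x =
      mu k * (monomial [:: i; j] x * diffop al p x).
    exact: diffop_sigma.
  have s2 p : diffop al p x * sigma j k x =
      mu i * (monomial [:: j; k] x * diffop al p x).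
    by have := diffop_sigma p i x; rewrite /i !ord3E.
  have s3 p : diffop al p x * sigma k i x =
      mu j * (monomial [:: k; i] x * diffop al p x).
    by have := diffop_sigma p j x; rewrite /j !ord3E.
  rewrite /tau !(partial_diffop al sal) mulrBl !s1 !s2 !s3 /l !big_cons big_nil /=.
  rewrite !(monomial_cons _ [:: _; _]).
  clearbody i j; do ![move: (diffop al _ x) => ?]; do ![move: (monomial _ x) => ?].
  move: (x 0 i) (x 0 j) => xi xj.
  ring.
move=> H; rewrite (_ : _ * _ =
  \sum_(z <- l) z.1.1 * \sum_(q <- z.2) q.1 * pairing al z.1.2 q.2)//.
have e1 : tau_op i j = [:: (w i, [:: k; i]); (w j, [:: k; j]); (- w k, [:: k; k])].
  by rewrite /tau_op /i /j !ord3E.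
have e2 : tau_op k i = [:: (w k, [:: j; k]); (w i, [:: j; i]); (- w j, [:: j; j])].
  by rewrite /tau_op /i /j !ord3E.
have e3 : tau_op k j = [:: (w k, [:: i; k]); (w j, [:: i; j]); (- w i, [:: i; i])].
  by rewrite /tau_op /i /j !ord3E.
have e4 : tau_op i i = [:: (- 2 * w i, [:: j; k])].
  by rewrite /tau_op /i /j eqxx !ord3E.
have e5 : tau_op j j = [:: (- 2 * w j, [:: k; i])].
  by rewrite /tau_op /i /j eqxx !ord3E.
have ne := (ord3E k).1.2; rewrite -/i -/j in ne.
rewrite {H}/l e1 e2 e3 e4 e5 {e1 e2 e3 e4 e5 l}; rewrite -/i -/j; clearbody i j.
rewrite /dop/= !big_cons !big_nil/=.
have Z s t a : (count_mem a s < count_mem a t)%N -> pairing al s t = 0.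
  exact: pairing_eq0.
have P s t : perm_eq s t -> uniq t -> _ := pairing_perm s t r0.
(* The last argument of [Z] is an index occurring more often in the derivative than in the
   monomial. *)
rewrite !(Z [:: i; i; j] _ k) /= ?eqxx ?ne//.
rewrite !(Z [:: j; i; j] _ k) /= ?eqxx ?ne//.
rewrite !(Z [:: i; k; i] _ j) /= ?eqxx ?ne//.
rewrite (Z [:: j; k; i] [:: i; j; i] i) /= ?eqxx ?ne//.
rewrite (Z [:: j; k; i] [:: i; j; j] j) /= ?eqxx ?ne//.
rewrite (Z [:: i; j; k] [:: j; i; j] j) /= ?eqxx ?ne//.
rewrite (Z [:: i; j; k] [:: j; i; i] i) /= ?eqxx ?ne//.
rewrite !(Z [:: j; j; k] _ i) /= ?eqxx ?ne//.
rewrite (Z [:: k; i] [:: i; j] j) /= ?eqxx ?ne//.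
rewrite (Z [:: k; i] [:: i; i] i) /= ?eqxx ?ne//.
rewrite !(Z [:: i; j] _ k) /= ?eqxx ?ne//.
rewrite (Z [:: j; k] [:: j; i] i) /= ?eqxx ?ne//.
rewrite (Z [:: j; k] [:: j; j] j) /= ?eqxx ?ne//.
(* Four pairings survive, two of order 3 with sign $-1$ and two of order 2 with sign $+1$; together
   they give $2w_k(\mu_j-\mu_i)$ times the product of the masses. *)
rewrite !P /= ?inE ?ne// /perm_eq /= ?eqxx ?ne//.
ring.
Qed.

End Construction.

(** Each summand has a factor [s i j], which vanishes off the shell. *)
Lemma integral_A1_integrand (R : realType) (s t : 'I_3 -> 'I_3 -> 'rV[R]_3 -> R) k :
  (forall i j, compact_support_in_A1 (s i j)) ->
  integral_A1 (integrand s t k) = integral3 (integrand s t k).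
Proof.
move=> sA; congr (integral3 _); apply/funext => x; case: asboolP => // xA.
rewrite /integrand big1// => i _; rewrite big1// => j _; rewrite big1// => l _.
suff -> : s i j x = 0 by rewrite mulr0.
by apply: contra_notP xA => /eqP sx; apply: (sA i j).2; exact: subset_closure.
Qed.

(** * Choice of the bumps and of the weights *)

Section Witness.
Context {R : realType}.
Implicit Types (j k : 'I_3).

(** With [upper], this confines $x_0^2$ to $[5/4,9/4]$ and the other squares to at most 1/2, so
    $5/4\le|x|^2\le 13/4$. The value [- 1] disables the lower cutoff, margins included. *)
Definition lower j : R := if j == 0 then 5 / 4 else - 1.
Definition upper j : R := if j == 0 then 9 / 4 else 1 / 2.

(** The values $-1,0,1$ are distinct and have sum 0. *)
Definition weight j : R := (val j)%:R - 1.

Definition profile j : R -> R := cutid (lower j) (upper j).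
Definition bumps j : R -> R := sqbump (lower j) (upper j).

Lemma upper_lt j : upper j < 4.
Proof. by rewrite /upper; case: ifP => _; lra. Qed.

Lemma sum_upper : \sum_j upper j < 4.
Proof. by rewrite !big_ord_recl big_ord0 /upper/=; lra. Qed.

Lemma sum_weight : \sum_j weight j = 0.
Proof. by rewrite !big_ord_recr big_ord0 /weight/=; ring. Qed.

Lemma weightB_neq0 k : weight (k + 2%:R) - weight (k + 1) != 0.
Proof. by rewrite /weight opprB addrA addrNK subr_eq0 eqr_nat val_eqE ord3E. Qed.

Lemma profile_eq0 j n y :
  ~ sqitv (lower j) (upper j) y -> derive1n n (profile j) y = 0.
Proof. by apply: derive1n_sqitv => z; exact: cutid_eq0. Qed.

Lemma bumps_eq0 j n y :
  ~ sqitv (lower j) (upper j) y -> derive1n n (bumps j) y = 0.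
Proof.
apply: derive1n_sqitv => z zj; apply: sqbump_eq0 => zj'; apply: zj.
by move: zj'; rewrite /sqitv/=; lra.
Qed.

Lemma bumps_eq0_itv j y : y \notin `]- 2, 2[ -> bumps j y = 0.
Proof.
move=> y2; apply: (bumps_eq0 j 0) => /andP[_ yj]; move/negP: y2; apply.
by have := upper_lt j; rewrite in_itv/= => ?; apply/andP; split; nra.
Qed.

Lemma smooth1_bumps j : smooth1 (bumps j).
Proof. exact: smooth1_sqbump. Qed.

Lemma smooth1_profile j : smooth1 (profile j).
Proof. exact: smooth1_cutid. Qed.

Lemma moment_bumps_gt0 j : 0 < moment (bumps j) 0 0.
Proof.
rewrite /moment; have -> : (fun x => x ^+ 0 * derive1n 0 (bumps j) x) = bumps j.
  by apply/funext => x; rewrite mul1r.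
(* The test points satisfy $3/2<(5/4)^2<2$ and $-3/4<0<1/4$. *)
apply: (@has_integral_gt0 _ _ 2 (if j == 0 then 5 / 4 else 0)).
- exact: (smooth1_continuous _ 0 (smooth1_bumps j)).
- by move=> x; exact: sqbump_ge0.
- move=> x x2; apply: bumps_eq0_itv; apply: contra x2; exact: subset_itv_oo_cc.
- by apply: sqbump_gt0; rewrite /lower /upper; case: ifP => _; lra.
Qed.

Lemma bumpsN j y : bumps j (- y) = 1 * bumps j y.
Proof. exact: sqbumpN. Qed.

Lemma profileN j y : profile j (- y) = - 1 * profile j y.
Proof. exact: cutidN. Qed.

Lemma bumps_profile j n m y : (m < 2)%N ->
  derive1n n (bumps j) y * derive1n m (profile j) y =
  derive1n n (bumps j) y * y ^+ (1 - m).
Proof. exact: sqbump_cutid. Qed.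

Lemma diffop_support (G : 'I_3 -> R -> R) p :
  (forall j n y, ~ sqitv (lower j) (upper j) y -> derive1n n (G j) y = 0) ->
  compact_support_in_A1 (diffop G p).
Proof.
move=> G0; apply: (@sqbox_compact_support _ lower upper _ 0).
  by rewrite /lower/=; lra.
  exact: sum_upper.
by move=> x px j; exact: (diffop_neq0 G p x _ G0 px).
Qed.

(** Three odd factors and one derivative give four signs, hence an even function. *)
Lemma admissible_sigma mu : admissible (sigma profile mu).
Proof.
split=> [i j|]; first exact/smooth_diffop/smooth1_profile.
split=> [i j|]; first exact: sigmaC.
split=> [i j|i j x]; first exact/diffop_support/profile_eq0.
symmetry; apply: (diffop_even _ smooth1_profile _ (fun=> - 1) _ profileN).
rewrite /sigma_op; case: eqP => // _ q; rewrite inE => /eqP ->.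
by rewrite !big_ord_recl big_ord0/=; ring.
Qed.

(** The factors are even and two derivatives are taken. *)
Lemma admissible_tau w : admissible (tau bumps w).
Proof.
split=> [i j|]; first exact/smooth_diffop/smooth1_bumps.
split=> [i j|]; first exact: tauC.
split=> [i j|i j x]; first exact/diffop_support/bumps_eq0.
symmetry; apply: (diffop_even _ smooth1_bumps _ (fun=> 1) _ bumpsN).
move=> q; rewrite /tau_op big1// mulr1; case: eqP => _.
  by rewrite inE => /eqP ->; rewrite sqrrN expr1n.
by rewrite !inE => /or3P[] /eqP ->; rewrite sqrrN expr1n.
Qed.

End Witness.

Theorem theorem2p7 (R : realType) (lam : 'I_3 -> R) :
  exists sigma tau : 'I_3 -> 'I_3 -> 'rV[R]_3 -> R,
    admissible sigma /\ admissible tau /\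
    (forall x, Lop sigma x = 0) /\
    (forall j x, divT tau j x = 0) /\
    (forall k, integral_A1 (integrand sigma tau k) = lam k).
Proof.
pose m : R := \prod_j moment (bumps j) 0 0.
have m0 : m != 0 by rewrite gt_eqF// prodr_gt0// => j _; exact: moment_bumps_gt0.
(* Solves $2w_k(\mu_{k+2}-\mu_{k+1})m=\lambda_k$ with [weight] for $\mu$. *)
pose w k : R := lam k / (2 * (weight (k + 2%:R) - weight (k + 1)) * m).
exists (sigma profile weight), (tau bumps w).
have As := admissible_sigma (@weight R).
split; first exact: As.
split; first exact: admissible_tau.
split=> [x|]; first exact: Lop_sigma smooth1_profile _ sum_weight.
split=> [j x|k]; first exact: divT_tau smooth1_bumps _ _.
rewrite integral_A1_integrand; last by case: As => _ [_ []].
have I := has_integral3_integrand _ _ weight w smooth1_bumps 2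
  bumps_eq0_itv bumps_profile k.
rewrite (has_integral3E _ _ (I _))// -/m /w.
by field; rewrite m0 weightB_neq0.
Qed.
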